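(* Let $\mu_0$ be a probability measure on $\mathbb R^+=[0,\infty)$ which has a density $\phi_0(x)$ with respect to Lebesgue measure that is decreasing and satisfies $$\phi_0(x)\sim c\,(\log x)^b\big/x^{3/2}\quad\text{as }x\to\infty,$$ where $b>1/2$ and $c>0$. Then the associated reflected random walk on $\mathbb R^+$ is transient.
   Context: The reflected random walk on $\mathbb R^+$ associated with $\mu_0$ is $X_0^x=x\ge0$, $X_n^x=|X_{n-1}^x-B_n|$, where $(B_n)_{n\ge1}$ are i.i.d. random variables with distribution $\mu_0$. It is transient if $\mathrm{Pr}[|X_n^x-x|\to\infty]=1$ for every $x\ge0$. *)

(* Defs.v *)
From HB Require Import structures.
From mathcomp Require Import all_boot all_order all_algebra.
From mathcomp Require Import all_classical all_reals all_analysis.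

Set Implicit Arguments.
Unset Strict Implicit.
Unset Printing Implicit Defensive.

Import Order.TTheory GRing.Theory Num.Theory.
Import numFieldNormedType.Exports.

Local Open Scope classical_set_scope.
Local Open Scope ring_scope.

(* The Landau notations expect a canonical [filter_on] structure, which the
   library does not declare for the filter at +oo. *)
Canonical pinfty_nbhs_filterType (R : numFieldType) :=
  FilterType (pinfty_nbhs R) filter_filter.

(* A probability measure on [0, +oo[ is represented as a Borel probability
   measure on R giving mass 1 to [0, +oo[; only the values of phi on [0, +oo[
   matter. *)
Definition has_density_on_Rplus (R : realType) (mu : probability R R)
    (phi : R -> R) : Prop :=
  [/\ measurable_fun (`[0, +oo[ : set R) phi,
      (forall x, 0 <= x -> 0 <= phi x) &
      forall A : set R, measurable A ->
        mu A = (\int[lebesgue_measure]_(x in A `&` `[0%R, +oo[) (phi x)%:E)%E].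

Definition mutually_independent (d : measure_display) (T : measurableType d)
    (R : realType) (P : probability T R) (B : nat -> {RV P >-> R}) : Prop :=
  forall (J : seq nat) (A : nat -> set R),
    uniq J -> (forall n, measurable (A n)) ->
    P (\bigcap_(n in [set` J]) B n @^-1` A n) =
      (\prod_(n <- J) P (B n @^-1` A n))%E.

Definition iid_with_law (d : measure_display) (T : measurableType d)
    (R : realType) (P : probability T R) (B : nat -> {RV P >-> R})
    (mu : probability R R) : Prop :=
  mutually_independent B /\
  forall n (A : set R), measurable A -> distribution P (B n) A = mu A.

(* The increments are indexed from 0: B n is the increment of step n + 1. *)
Fixpoint reflected_walk (T : Type) (R : realType) (B : nat -> T -> R) (x : R)
    (n : nat) (w : T) : R :=
  if n is m.+1 then `|reflected_walk B x m w - B m w| else x.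

Definition transient_reflected_walk (d : measure_display)
    (T : measurableType d) (R : realType) (P : probability T R)
    (B : nat -> {RV P >-> R}) : Prop :=
  forall x : R, 0 <= x ->
    P [set w | `|reflected_walk B x n w - x| @[n --> \oo] --> +oo] = 1%E.

(* Main.v *)
(* Write B for a step, mu(t) = E[exp(i t B)], and let h(x) be the integral of
   w(t) cos(t x) dt over [0, a] with w(t) = a - t, a positive multiple of the
   Fejer kernel, so that h >= 0.  For r < 1 consider
     f(x) = \int w cos(t x) / |1 - r mu|^2 dt,
     g(x) = Re \int w exp(i t x) / (1 - r mu) dt.
   Then f(x) - r E f(x - B) = g(x) and g(x) - r E g(x + B) = h(x).  The second
   identity and h >= 0 force g >= h (the renewal measure of B is positive).  As
   f is even, f(|x - B|) = f(x - B), so the first identity makes f a potential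
   for the reflected walk X and sum_k r^k E h(X_k) <= 2 sup |f|.  The latter is
   at most the integral of w / |1 - r mu|^2, which stays bounded as r -> 1
   because |1 - mu(t)|^2 is at least a multiple of t (log (1/t))^(2b) near 0 and
   2b > 1.  Hence sum_k P(X_k <= M) converges for all M, and Borel-Cantelli
   concludes. *)

Require Import Defs.
From HB Require Import structures.
From mathcomp Require Import all_boot all_order all_algebra.
From mathcomp Require Import all_classical all_reals all_analysis.
From mathcomp Require Import measurable_realfun ring lra.

Set Implicit Arguments.
Unset Strict Implicit.
Unset Printing Implicit Defensive.

Import Order.TTheory GRing.Theory Num.Theory.
Import numFieldNormedType.Exports.

Local Open Scope classical_set_scope.
Local Open Scope ring_scope.

(** * Integrals of bounded measurable functions *)

(** A class stable under sums, products and measurable changes of variable, and integrable against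
    every probability. All integrands below are kept in it, so that linearity and Fubini always
    apply. *)
Definition bounded_measurable d (T : measurableType d) (R : realType)
    (f : T -> R) : Prop :=
  measurable_fun setT f /\ exists M, forall x, `|f x| <= M.

Section bounded_measurable_theory.
Context d (T : measurableType d) (R : realType).
Implicit Types f g : T -> R.

Lemma bounded_measurable_cst (c : R) : bounded_measurable (fun _ : T => c).
Proof. by split; [exact: measurable_cst|exists `|c|]. Qed.

Lemma bounded_measurableN f :
  bounded_measurable f -> bounded_measurable (fun x => - f x).
Proof.
move=> [mf [M fM]]; split; first exact: measurable_funN.
by exists M => x; rewrite normrN.
Qed.

Lemma bounded_measurableD f g : bounded_measurable f -> bounded_measurable g ->
  bounded_measurable (fun x => f x + g x).
Proof.
move=> [mf [M fM]] [mg [N gN]]; split; first exact: measurable_funD.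
by exists (M + N) => x; rewrite (le_trans (ler_normD _ _))// lerD.
Qed.

Lemma bounded_measurableB f g : bounded_measurable f -> bounded_measurable g ->
  bounded_measurable (fun x => f x - g x).
Proof.
by move=> ? ?; apply: bounded_measurableD => //; exact: bounded_measurableN.
Qed.

Lemma bounded_measurableM f g : bounded_measurable f -> bounded_measurable g ->
  bounded_measurable (fun x => f x * g x).
Proof.
move=> [mf [M fM]] [mg [N gN]]; split; first exact: measurable_funM.
by exists (M * N) => x; rewrite normrM ler_pM.
Qed.

Lemma bounded_measurable_comp d' (T' : measurableType d') f (k : T' -> T) :
  bounded_measurable f -> measurable_fun setT k ->
  bounded_measurable (fun x => f (k x)).
Proof.
move=> [mf [M fM]] mk; split; first exact: measurableT_comp.
by exists M.
Qed.

Lemma bounded_measurable_integrable (P : probability T R) f :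
  bounded_measurable f -> P.-integrable setT (EFin \o f).
Proof.
move=> [mf [M fM]]; apply: measurable_bounded_integrable => //.
  exact: le_lt_trans (probability_le1 _ measurableT) (ltry _).
exists M; split; first exact: num_real.
by move=> x Mx y _; exact: le_trans (fM y) (ltW Mx).
Qed.

Lemma bounded_measurable_le_Rintegral (P : probability T R) f g :
  bounded_measurable f -> bounded_measurable g -> (forall x, f x <= g x) ->
  \int[P]_x f x <= \int[P]_x g x.
Proof.
by move=> bf bg fg; apply: le_Rintegral => //; exact: bounded_measurable_integrable.
Qed.

Lemma Rintegral_probability_cst (P : probability T R) (c : R) :
  \int[P]_x c = c.
Proof.
rewrite Rintegral_cst// [X in fine X](_ : _ = 1%E) ?mulr1//.
exact: probability_setT.
Qed.

Lemma bounded_measurable_normr_Rintegral (P : probability T R) f M :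
  measurable_fun setT f -> (forall x, `|f x| <= M) -> `|\int[P]_x f x| <= M.
Proof.
move=> mf fM; have bf : bounded_measurable f by split=> //; exists M.
rewrite (le_trans (le_normr_Rintegral _ _))//.
  exact: bounded_measurable_integrable.
rewrite -[leRHS](Rintegral_probability_cst P).
apply: bounded_measurable_le_Rintegral => //; last exact: bounded_measurable_cst.
split; first exact: measurableT_comp.
by exists M => x; rewrite normr_id.
Qed.

Lemma EFin_Rintegral (P : probability T R) f : bounded_measurable f ->
  (\int[P]_x f x)%:E = (\int[P]_x (f x)%:E)%E.
Proof.
move=> bf; rewrite /Rintegral fineK//.
by apply: integrable_fin_num => //; exact: bounded_measurable_integrable.
Qed.

End bounded_measurable_theory.

Section bounded_measurable_trigo.
Context d (T : measurableType d) (R : realType).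

Lemma bounded_measurable_cos (f : T -> R) :
  measurable_fun setT f -> bounded_measurable (fun x => cos (f x)).
Proof.
move=> mf; split; last by exists 1 => x; exact: cos_max.
apply: measurableT_comp => //.
by apply: continuous_measurable_fun; exact: continuous_cos.
Qed.

Lemma bounded_measurable_sin (f : T -> R) :
  measurable_fun setT f -> bounded_measurable (fun x => sin (f x)).
Proof.
move=> mf; split; last by exists 1 => x; exact: sin_max.
apply: measurableT_comp => //.
by apply: continuous_measurable_fun; exact: continuous_sin.
Qed.

End bounded_measurable_trigo.

Section bounded_measurable_prod.
Context d1 d2 (T1 : measurableType d1) (T2 : measurableType d2) (R : realType).
Variables (P1 : probability T1 R) (P2 : probability T2 R).
Variable F : T1 * T2 -> R.
Hypothesis bF : bounded_measurable F.

Lemma bounded_measurable_section1 x : bounded_measurable (fun y => F (x, y)).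
Proof. exact: bounded_measurable_comp bF (measurable_pair1 x). Qed.

Lemma bounded_measurable_section2 y : bounded_measurable (fun x => F (x, y)).
Proof. exact: bounded_measurable_comp bF (measurable_pair2 y). Qed.

Let iF : (P1 \x P2)%E.-integrable setT (EFin \o F).
Proof. exact: (bounded_measurable_integrable (P1 \x P2)%E bF). Qed.

Lemma bounded_measurable_Rintegral1 :
  bounded_measurable (fun x => \int[P2]_y F (x, y)).
Proof.
have [mF [M FM]] := bF; split; last first.
  exists M => x; apply: bounded_measurable_normr_Rintegral => //.
  by have [] := bounded_measurable_section1 x.
apply/measurable_EFinP.
rewrite [X in measurable_fun _ X](_ : _ = fubini_F P2 (EFin \o F)).
  exact: measurable_fubini_F iF.
apply/funext => x /=; rewrite EFin_Rintegral//.
exact: bounded_measurable_section1.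
Qed.

Lemma Rintegral_prod1 :
  \int[P1]_x \int[P2]_y F (x, y) = \int[(P1 \x P2)%E]_z F z.
Proof.
rewrite [RHS]/Rintegral -(integral12_prod_meas1 iF); congr fine.
apply: eq_integral => x _; rewrite EFin_Rintegral//.
exact: bounded_measurable_section1.
Qed.

Lemma Rintegral_prod2 :
  \int[P2]_y \int[P1]_x F (x, y) = \int[(P1 \x P2)%E]_z F z.
Proof.
rewrite [RHS]/Rintegral -(integral21_prod_meas1 iF); congr fine.
apply: eq_integral => x _; rewrite EFin_Rintegral//.
exact: bounded_measurable_section2.
Qed.

Lemma Rintegral_swap :
  \int[P1]_x \int[P2]_y F (x, y) = \int[P2]_y \int[P1]_x F (x, y).
Proof. by rewrite Rintegral_prod1 Rintegral_prod2. Qed.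

End bounded_measurable_prod.

(** * Trigonometric integrals and the resolvent identities *)

Section trig_integral.
Context (R : realType).
Variable rho : probability R R.

Definition mean_cos (mu : probability R R) (t : R) : R :=
  \int[mu]_y cos (t * y).

Definition mean_sin (mu : probability R R) (t : R) : R :=
  \int[mu]_y sin (t * y).

(** Real part of the integral of (p - i q) exp(i t x) against [rho]. The complex coefficient p - i q
    is carried as a pair of real functions, so that only real integrals occur. *)
Definition trig_integral (p q : R -> R) (x : R) : R :=
  \int[rho]_t (p t * cos (t * x) + q t * sin (t * x)).

Let measurable_mulfs : measurable_fun setT (fun z : R * R => z.1 * z.2).
Proof. exact: measurable_funM. Qed.

Lemma bounded_measurable_cosM (x : R) :
  bounded_measurable (fun t : R => cos (t * x)).
Proof. by apply: bounded_measurable_cos; exact: measurable_funM. Qed.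

Lemma bounded_measurable_sinM (x : R) :
  bounded_measurable (fun t : R => sin (t * x)).
Proof. by apply: bounded_measurable_sin; exact: measurable_funM. Qed.

Lemma bounded_measurable_mean_cos mu : bounded_measurable (mean_cos mu).
Proof.
exact: (bounded_measurable_Rintegral1 mu mu
  (bounded_measurable_cos measurable_mulfs)).
Qed.

Lemma bounded_measurable_mean_sin mu : bounded_measurable (mean_sin mu).
Proof.
exact: (bounded_measurable_Rintegral1 mu mu
  (bounded_measurable_sin measurable_mulfs)).
Qed.

Lemma mean_cos_le1 mu t : mean_cos mu t <= 1.
Proof.
rewrite -[leRHS](Rintegral_probability_cst mu).
apply: bounded_measurable_le_Rintegral => [||y]; last exact: cos_le1.
  by apply: bounded_measurable_cos; exact: measurable_funM.
exact: bounded_measurable_cst.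
Qed.

Section coefficients.
Variables p q : R -> R.
Hypotheses (bp : bounded_measurable p) (bq : bounded_measurable q).

Let bounded_measurable_kernel : bounded_measurable
  (fun z : R * R => p z.1 * cos (z.1 * z.2) + q z.1 * sin (z.1 * z.2)).
Proof.
apply: bounded_measurableD; apply: bounded_measurableM.
- exact: bounded_measurable_comp bp measurable_fst.
- exact: bounded_measurable_cos.
- exact: bounded_measurable_comp bq measurable_fst.
- exact: bounded_measurable_sin.
Qed.

Lemma bounded_measurable_trig_integrand x :
  bounded_measurable (fun t => p t * cos (t * x) + q t * sin (t * x)).
Proof. exact: (bounded_measurable_section2 bounded_measurable_kernel x). Qed.

Lemma bounded_measurable_trig_integral :
  bounded_measurable (trig_integral p q).
Proof.
have bk := bounded_measurable_comp bounded_measurable_kernel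
  (@measurable_swap _ _ R R).
exact: (bounded_measurable_Rintegral1 rho rho bk).
Qed.

(** Translation by x multiplies the coefficient p - i q by exp(i t x); the new pair consists of the
    components of that product. *)
Lemma trig_integralD x y : trig_integral p q (x + y) =
  trig_integral (fun t => p t * cos (t * x) + q t * sin (t * x))
    (fun t => q t * cos (t * x) - p t * sin (t * x)) y.
Proof.
by apply: eq_Rintegral => t _; rewrite mulrDr cosD sinD; ring.
Qed.

Lemma Rintegral_trig_integral (mu : probability R R) :
  \int[mu]_y trig_integral p q y =
  \int[rho]_t (p t * mean_cos mu t + q t * mean_sin mu t).
Proof.
rewrite -(Rintegral_swap rho mu bounded_measurable_kernel) /=.
apply: eq_Rintegral => t _.
have bcos : bounded_measurable (fun y : R => cos (t * y)).
  by apply: bounded_measurable_cos; exact: measurable_funM.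
have bsin : bounded_measurable (fun y : R => sin (t * y)).
  by apply: bounded_measurable_sin; exact: measurable_funM.
rewrite RintegralD//; last 2 first.
- apply: bounded_measurable_integrable.
  by apply: bounded_measurableM => //; exact: bounded_measurable_cst.
- apply: bounded_measurable_integrable.
  by apply: bounded_measurableM => //; exact: bounded_measurable_cst.
by rewrite !RintegralZl//; exact: bounded_measurable_integrable.
Qed.

End coefficients.

(** By Fubini, averaging over the shift y multiplies p - i q by the characteristic function
    [mean_cos] + i [mean_sin]. *)
Lemma Rintegral_trig_integralD p q (mu : probability R R) x :
  bounded_measurable p -> bounded_measurable q ->
  \int[mu]_y trig_integral p q (x + y) =
  trig_integral (fun t => p t * mean_cos mu t + q t * mean_sin mu t)
    (fun t => q t * mean_cos mu t - p t * mean_sin mu t) x.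
Proof.
move=> bp bq; under eq_Rintegral do rewrite trig_integralD//.
rewrite Rintegral_trig_integral.
- by apply: eq_Rintegral => t _; ring.
- exact: bounded_measurable_trig_integrand.
- apply: bounded_measurableB; apply: bounded_measurableM => //.
    exact: bounded_measurable_cosM.
  exact: bounded_measurable_sinM.
Qed.

Lemma trig_integralN p x :
  trig_integral p (fun=> 0) (- x) = trig_integral p (fun=> 0) x.
Proof. by apply: eq_Rintegral => t _; rewrite mulrN cosN !mul0r. Qed.

Lemma trig_integralB p q p' q' c x :
  bounded_measurable p -> bounded_measurable q ->
  bounded_measurable p' -> bounded_measurable q' ->
  trig_integral p q x - c * trig_integral p' q' x =
  trig_integral (fun t => p t - c * p' t) (fun t => q t - c * q' t) x.
Proof.
move=> bp bq bp' bq'; rewrite /trig_integral -RintegralZl//; last first.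
  by apply: bounded_measurable_integrable; exact: bounded_measurable_trig_integrand.
rewrite -RintegralB//; last 2 first.
- by apply: bounded_measurable_integrable; exact: bounded_measurable_trig_integrand.
- apply: bounded_measurable_integrable.
  apply: bounded_measurableM; first exact: bounded_measurable_cst.
  exact: bounded_measurable_trig_integrand.
by apply: eq_Rintegral => t _; ring.
Qed.

End trig_integral.

(** * The potential, its charge and the two resolvent identities *)

Section resolvent.
Context (R : realType).
Variables (rho mu : probability R R) (w : R -> R) (r : R).
Hypothesis bw : bounded_measurable w.
Hypotheses (r_ge0 : 0 <= r) (r_lt1 : r < 1).

(* The squared modulus of 1 - r E[exp (i t B)]. *)
Definition resolvent_den (t : R) : R :=
  (1 - r * mean_cos mu t) ^+ 2 + (r * mean_sin mu t) ^+ 2.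

(** The real part is at least 1 - r because [mean_cos] <= 1. The bound degenerates as r tends to 1;
    it serves for positivity and boundedness at fixed r. *)
Lemma resolvent_den_ge t : (1 - r) ^+ 2 <= resolvent_den t.
Proof.
have := mean_cos_le1 mu t; rewrite /resolvent_den => C1.
have : 0 <= r * (1 - mean_cos mu t) by rewrite mulr_ge0// subr_ge0.
move=> rC; rewrite -[leLHS]addr0 lerD ?sqr_ge0//.
move: rC; rewrite mulrBr mulr1 subr_ge0 => rC.
by rewrite ler_sqr ?nnegrE ?subr_ge0 ?lerD2l ?lerN2// ltW// (le_lt_trans rC).
Qed.

Lemma resolvent_den_gt0 t : 0 < resolvent_den t.
Proof. by rewrite (lt_le_trans _ (resolvent_den_ge t))// exprn_gt0// subr_gt0. Qed.

Lemma bounded_measurable_resolvent_den : bounded_measurable resolvent_den.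
Proof.
have bC := bounded_measurable_mean_cos mu.
have bS := bounded_measurable_mean_sin mu.
apply: bounded_measurableD; apply: bounded_measurableM;
  try apply: bounded_measurableB; try apply: bounded_measurableM => //;
  exact: bounded_measurable_cst.
Qed.

Lemma bounded_measurable_inv_resolvent_den :
  bounded_measurable (fun t => (resolvent_den t)^-1).
Proof.
split.
  (* The inverse is read as the power -1, which is measurable; the two agree on positive values. *)
  rewrite [X in measurable_fun _ X](_ : _ = (@powR R ^~ (-1)) \o resolvent_den).
    by apply: measurableT_comp => //; have [] := bounded_measurable_resolvent_den.
  by apply/funext => t /=; rewrite powR_inv1// ltW// resolvent_den_gt0.
exists ((1 - r) ^+ 2)^-1 => t.
have r1 : 0 < (1 - r) ^+ 2 by rewrite exprn_gt0// subr_gt0.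
rewrite ger0_norm ?invr_ge0 ?(ltW (resolvent_den_gt0 _))//.
by rewrite lef_pV2 ?posrE ?resolvent_den_gt0// resolvent_den_ge.
Qed.

Definition potential : R -> R :=
  trig_integral rho (fun t => w t * (resolvent_den t)^-1) (fun=> 0).

(** The function g of the overview, [potential] being f: here p - i q is w times the conjugate of 1
    - r mu(t), divided by its squared modulus, that is w / (1 - r mu(t)). *)
Definition charge : R -> R :=
  trig_integral rho
    (fun t => w t * (resolvent_den t)^-1 * (1 - r * mean_cos mu t))
    (fun t => - (w t * (resolvent_den t)^-1 * (r * mean_sin mu t))).

Let bp : bounded_measurable (fun t => w t * (resolvent_den t)^-1).
Proof.
by apply: bounded_measurableM => //; exact: bounded_measurable_inv_resolvent_den.
Qed.

Let b0 : bounded_measurable (fun _ : R => 0 : R).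
Proof. exact: bounded_measurable_cst. Qed.

Let bcst (c : R) : bounded_measurable (fun _ : R => c).
Proof. exact: bounded_measurable_cst. Qed.

Let brS : bounded_measurable (fun t => r * mean_sin mu t).
Proof. by apply: bounded_measurableM => //; exact: bounded_measurable_mean_sin. Qed.

Let brC : bounded_measurable (fun t => r * mean_cos mu t).
Proof. by apply: bounded_measurableM => //; exact: bounded_measurable_mean_cos. Qed.

Let bP : bounded_measurable
  (fun t => w t * (resolvent_den t)^-1 * (1 - r * mean_cos mu t)).
Proof. by apply: bounded_measurableM => //; exact: bounded_measurableB. Qed.

Let bQ : bounded_measurable
  (fun t => - (w t * (resolvent_den t)^-1 * (r * mean_sin mu t))).
Proof. by apply: bounded_measurableN; exact: bounded_measurableM. Qed.

Lemma bounded_measurable_potential : bounded_measurable potential.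
Proof. exact: bounded_measurable_trig_integral. Qed.

Lemma bounded_measurable_charge : bounded_measurable charge.
Proof. exact: bounded_measurable_trig_integral. Qed.

Lemma potential_normr x : potential `|x| = potential x.
Proof.
case: (lerP 0 x) => [/ger0_norm -> //|/ltr0_norm ->].
exact: trig_integralN.
Qed.

Lemma potential_charge x :
  potential x - r * \int[mu]_y potential (x - y) = charge x.
Proof.
have bC := bounded_measurable_mean_cos mu.
have bS := bounded_measurable_mean_sin mu.
(* Evenness turns x - y into - x + y, so that the averaging formula for shifts applies at - x. *)
rewrite (@eq_Rintegral _ _ _ _ _ (fun y => potential (- x + y))); last first.
  by move=> y _; rewrite /potential -trig_integralN opprB addrC.
rewrite Rintegral_trig_integralD//.
(* Changing the sign of the argument conjugates the coefficient. The average thus contributes the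
   conjugate of mu(t), as the definition of [charge] requires. *)
have -> : forall p q, trig_integral rho p q (- x) =
    trig_integral rho p (fun t => - q t) x.
  by move=> p q; apply: eq_Rintegral => t _; rewrite mulrN cosN sinN; ring.
rewrite trig_integralB//; last 2 first.
- apply: bounded_measurableD; exact: bounded_measurableM.
- apply: bounded_measurableN; apply: bounded_measurableB; exact: bounded_measurableM.
by apply: eq_Rintegral => t _; ring.
Qed.

(** The coefficient w / (1 - r mu) is multiplied by 1 - r mu, which leaves w. *)
Lemma charge_renewal x :
  charge x - r * \int[mu]_y charge (x + y) = trig_integral rho w (fun=> 0) x.
Proof.
have bC := bounded_measurable_mean_cos mu.
have bS := bounded_measurable_mean_sin mu.
rewrite Rintegral_trig_integralD// trig_integralB//; last 2 first.
- apply: bounded_measurableD; exact: bounded_measurableM.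
- apply: bounded_measurableB; exact: bounded_measurableM.
apply: eq_Rintegral => t _; congr (_ * _ + _ * _); last by ring.
have := lt0r_neq0 (resolvent_den_gt0 t); rewrite /resolvent_den => D0.
by field.
Qed.

(** A minimum principle. Let m be the infimum of the bounded function g. The renewal identity gives
    g >= h + r m, hence m >= r m because h >= 0, and m >= 0 because r < 1. Then g >= h + r m >=
    h. *)
Lemma charge_ge x : (forall y, 0 <= trig_integral rho w (fun=> 0) y) ->
  trig_integral rho w (fun=> 0) x <= charge x.
Proof.
move=> h_ge0; have [_ [M gM]] := bounded_measurable_charge.
have glb : has_inf (range charge).
  split; first by exists (charge 0), 0.
  by exists (- M) => _ [y _ <-]; have /ler_normlP[] := gM y; rewrite lerNl.
pose m := inf (range charge).
have gm y : m <= charge y by apply: ge_inf; [exact: (proj2 glb)|exists y].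
have gint y : m <= \int[mu]_z charge (y + z).
  rewrite -[leLHS](Rintegral_probability_cst mu).
  apply: bounded_measurable_le_Rintegral => //.
  apply: bounded_measurable_comp bounded_measurable_charge _.
  exact: measurable_funD.
have gE y : trig_integral rho w (fun=> 0) y + r * m <= charge y.
  rewrite -charge_renewal -[leRHS]addr0 -addrA lerD2l.
  by rewrite addrC subr_le0 ler_wpM2l.
have m0 : 0 <= m.
  have : r * m <= m.
    apply: lb_le_inf; first exact: (proj1 glb).
    by move=> _ [y _ <-]; rewrite (le_trans _ (gE y))// lerDr.
  rewrite -subr_ge0 -[X in X - _]mul1r -mulrBl pmulr_rge0// subr_gt0//.
by rewrite (le_trans _ (gE x))// lerDl mulr_ge0.
Qed.

Lemma potential_le K x : (forall t, 0 <= w t) ->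
  \int[rho]_t (w t * (resolvent_den t)^-1) <= K -> `|potential x| <= K.
Proof.
move=> w0; apply: le_trans.
have bi := bounded_measurable_trig_integrand bp b0 x.
rewrite (le_trans (le_normr_Rintegral _ _))//.
  exact: bounded_measurable_integrable.
apply: bounded_measurable_le_Rintegral => //.
  split; first by apply: measurableT_comp => //; have [] := bi.
  by have [_ [N iN]] := bi; exists N => t; rewrite normr_id.
move=> t; rewrite mul0r addr0 normrM.
have p0 : 0 <= w t * (resolvent_den t)^-1.
  by rewrite mulr_ge0// invr_ge0 ltW// resolvent_den_gt0.
by rewrite (ger0_norm p0) ler_piMr// cos_max.
Qed.

End resolvent.

(** * The reflected walk *)

Section pair_mfun.
Context d (T : measurableType d) (R : realType).
Variables X Y : {mfun T >-> R}.

(** The pair is made a measurable function in its own right, so that its joint law can be formed. *)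
Definition pair_mfun (w : T) : R * R := (X w, Y w).

Lemma measurable_pair_mfun : measurable_fun setT pair_mfun.
Proof. exact: measurable_fun_pair. Qed.

HB.instance Definition _ :=
  isMeasurableFun.Build _ _ _ _ pair_mfun measurable_pair_mfun.

End pair_mfun.

Section independent_pair.
Context d (T : measurableType d) (R : realType) (P : probability T R).
Variables X Y : {RV P >-> R}.

(** As functions of S, both sides are finite measures on the plane. They agree on measurable
    rectangles, which are stable under intersection and generate the product sigma-algebra. *)
Lemma independent_pair_event (E : set T) : measurable E ->
  (forall A B, measurable A -> measurable B ->
    (P (X @^-1` A `&` Y @^-1` B `&` E) =
     P (X @^-1` A `&` Y @^-1` B) * P E)%E) ->
  forall S, measurable S ->
    (P (pair_mfun X Y @^-1` S `&` E) = P (pair_mfun X Y @^-1` S) * P E)%E.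
Proof.
move=> mE XYE S mS.
have PE0 : 0 <= fine (P E) by exact: fine_ge0.
pose m1 : {measure set (R * R) -> \bar R} :=
  pushforward (mrestr P mE) (pair_mfun X Y).
pose m2 : {measure set (R * R) -> \bar R} :=
  mscale (NngNum PE0) (distribution P (pair_mfun X Y)).
have PE : ((fine (P E))%:E = P E)%E by rewrite fineK// fin_num_measure.
rewrite muleC -{}PE.
change (m1 (measurable_pair_mfun X Y) S = m2 S).
pose C : set (set (R * R)) :=
  [set C | exists A, measurable A /\ exists B, measurable B /\ C = A `*` B].
apply: (measure_unique C (fun=> setT `*` setT)) => //.
- rewrite measurable_prod_measurableType //; congr (<<s _ >>).
  rewrite predeqE; split => [[A mA [B mB <-]]|[A [mA [B [mB ->]]]]].
    by exists A; split => //; exists B.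
  by exists A => //; exists B.
- move=> /= _ _ [X1 [mX1 [X2 [mX2 ->]]]] [Y1 [mY1 [Y2 [mY2 ->]]]].
  rewrite -setXI; exists (X1 `&` Y1); split; first exact: measurableI.
  by exists (X2 `&` Y2); split => //; exact: measurableI.
- by move=> _; exists setT; split => //; exists setT.
- by rewrite bigcup_const// setXTT.
- move=> _ [A [mA [B [mB ->]]]].
  change (P (X @^-1` A `&` Y @^-1` B `&` E) =
    (fine (P E))%:E * P (X @^-1` A `&` Y @^-1` B))%E.
  by rewrite XYE// fineK ?fin_num_measure// muleC.
- move=> _; rewrite setXTT; change (P (setT `&` E) < +oo)%E.
  by rewrite setTI (le_lt_trans (probability_le1 _ mE))// ltry.
Qed.

(** By uniqueness of the product measure, the joint law of (X, Y) is the law of X times [mu]; Fubini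
    then integrates out the second coordinate first. *)
Lemma Rintegral_independent_pair (mu : probability R R) (F : R * R -> R) :
  (forall A B, measurable A -> measurable B ->
    (P (X @^-1` A `&` Y @^-1` B) = P (X @^-1` A) * P (Y @^-1` B))%E) ->
  (forall A, measurable A -> distribution P Y A = mu A) ->
  bounded_measurable F ->
  \int[P]_w F (X w, Y w) = \int[P]_w \int[mu]_y F (X w, y).
Proof.
move=> XY Ymu bF.
have mXY := measurable_pair_mfun X Y.
have bF1 : bounded_measurable (fun x => \int[mu]_y F (x, y)).
  exact: (bounded_measurable_Rintegral1 mu mu bF).
have mEFin (d' : measure_display) (U : measurableType d') (f : U -> R) :
  bounded_measurable f -> measurable_fun setT (EFin \o f).
  by move=> [mf _]; exact/measurable_EFinP.
transitivity (\int[distribution P (pair_mfun X Y)]_z F z).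
  rewrite /Rintegral integral_distribution//; first exact: mEFin.
  apply: (bounded_measurable_integrable P (f := F \o pair_mfun X Y)).
  exact: bounded_measurable_comp.
transitivity (\int[(distribution P X \x mu)%E]_z F z).
  rewrite /Rintegral; congr fine; apply: eq_measure_integral => S mS _.
  symmetry; apply: product_measure_unique => // A B mA mB.
  by apply: etrans (XY A B mA mB) _; congr (_ * _)%E; exact: Ymu.
rewrite -Rintegral_prod1//.
rewrite [LHS]/Rintegral integral_distribution//; first exact: mEFin.
apply: (bounded_measurable_integrable P (f := fun w => \int[mu]_y F (X w, y))).
exact: (bounded_measurable_comp (k := X) bF1).
Qed.

End independent_pair.

Section reflected_walk_law.
Context d (T : measurableType d) (R : realType) (P : probability T R).
Variables (B : nat -> {RV P >-> R}) (x : R).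

Lemma measurable_reflected_walk n : measurable_fun setT (reflected_walk B x n).
Proof.
elim: n => [|n IHn] /=; first exact: measurable_cst.
by apply: measurableT_comp => //; exact: measurable_funB.
Qed.

HB.instance Definition _ n := isMeasurableFun.Build _ _ _ _
  (reflected_walk B x n) (measurable_reflected_walk n).

Variable mu : probability R R.
Hypothesis B_iid : iid_with_law B mu.

(** [B k] drives the step from k to k + 1, so the walk at time k involves only increments of index
    below k. The induction is on k: the walk at time k + 1 is a function of the walk at time k and
    of [B k], and [B k] joins the list of future increments. *)
Lemma reflected_walk_independent_future k (J : seq nat) (A : set R)
    (C : nat -> set R) : measurable A -> (forall n, measurable (C n)) ->
  uniq J -> all (leq k) J ->
  (P (reflected_walk B x k @^-1` A `&` \bigcap_(n in [set` J]) B n @^-1` C n) =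
   P (reflected_walk B x k @^-1` A) *
   P (\bigcap_(n in [set` J]) B n @^-1` C n))%E.
Proof.
have mcyl (J' : seq nat) (C' : nat -> set R) : (forall n, measurable (C' n)) ->
    measurable (\bigcap_(n in [set` J']) B n @^-1` C' n).
  move=> mC'; apply: fin_bigcap_measurable => // n _.
  exact: measurable_funPTI.
elim: k J A C => [|k IHk] J A C mA mC uJ kJ.
  have [Ax|nAx] := pselect (A x).
    have -> : reflected_walk B x 0 @^-1` A = setT by apply/seteqP; split.
    by rewrite setTI probability_setT mul1e.
  have -> : reflected_walk B x 0 @^-1` A = set0 by apply/seteqP; split.
  by rewrite set0I measure0 mul0e.
pose S : set (R * R) := [set z | A `|z.1 - z.2|].
have mS : measurable S.
  have msub : measurable_fun setT (fun z : R * R => `|z.1 - z.2|).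
    by apply: measurableT_comp => //; exact: measurable_funB.
  by rewrite -[S]setTI; exact: (msub measurableT A mA).
have -> : reflected_walk B x k.+1 @^-1` A =
    pair_mfun (reflected_walk B x k) (B k) @^-1` S by [].
apply: independent_pair_event => //; first exact: mcyl.
move=> D E mD mE.
have kNJ : k \notin J by apply/negP => /(allP kJ); rewrite ltnn.
(* The constraint on [B k] is added to the family of constraints; those indexed by J are unchanged
   since k is not in J. *)
pose C' n := if n == k then E else C n.
have mC' n : measurable (C' n) by rewrite /C'; case: ifP.
have C'J : \bigcap_(n in [set` J]) B n @^-1` C n =
    \bigcap_(n in [set` J]) B n @^-1` C' n.
  apply: eq_bigcapr => n /= nJ; rewrite /C' ifN//.
  by apply: contraNneq kNJ => <-.
have C'kJ : B k @^-1` E `&` \bigcap_(n in [set` J]) B n @^-1` C n =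
    \bigcap_(n in [set` k :: J]) B n @^-1` C' n.
  by rewrite C'J !bigcap_seq big_cons /C' eqxx.
have C'k : B k @^-1` E = \bigcap_(n in [set` [:: k]]) B n @^-1` C' n.
  by rewrite bigcap_seq big_seq1 /C' eqxx.
have leqJ : all (leq k) J by apply: sub_all kJ => n; exact: ltnW.
(* The induction hypothesis is used twice, for the list k :: J and for k alone; independence of the
   increments then splits off the factor of [B k]. *)
rewrite -setIA C'kJ IHk//=; last 2 first.
- by rewrite kNJ.
- by rewrite leqnn.
rewrite C'k IHk//= ?leqnn// -C'k C'J.
have [indep _] := B_iid.
rewrite !indep//= ?kNJ//.
by rewrite big_cons muleA /C' eqxx.
Qed.

Lemma Rintegral_reflected_walkS (f : R -> R) k : bounded_measurable f ->
  (forall y, f `|y| = f y) ->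
  \int[P]_w f (reflected_walk B x k.+1 w) =
  \int[P]_w \int[mu]_y f (reflected_walk B x k w - y).
Proof.
move=> bf feven.
transitivity (\int[P]_w f (reflected_walk B x k w - B k w)).
  by apply: eq_Rintegral => w _; rewrite /= feven.
apply: (@Rintegral_independent_pair _ _ _ P (reflected_walk B x k) (B k) mu
  (fun z => f (z.1 - z.2))).
- move=> A E mA mE.
  have := @reflected_walk_independent_future k [:: k] A (fun=> E) mA.
  by rewrite bigcap_seq big_seq1 /= leqnn; apply.
- by have [_] := B_iid; apply.
- apply: bounded_measurable_comp bf _.
  exact: measurable_funB.
Qed.

End reflected_walk_law.

(** * Discounted sums and the bound on the Green function *)

Lemma bernoulli_ineq (R : realDomainType) (y : R) n : 0 <= y <= 1 ->
  1 - n%:R * y <= (1 - y) ^+ n.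
Proof.
move=> /andP[y0 y1]; elim: n => [|n IHn]; first by rewrite mul0r subr0 expr0.
have y1' : 0 <= 1 - y by rewrite subr_ge0.
rewrite exprS (le_trans _ (ler_wpM2l y1' IHn))//.
have : 0 <= n%:R * (y * y) by rewrite mulr_ge0// mulr_ge0.
by rewrite -natr1; set z := n%:R; nra.
Qed.

Lemma discounted_telescope (R : realDomainType) (r : R) (e u : nat -> R) n :
  0 <= r -> (forall k, u k <= e k - r * e k.+1) ->
  \sum_(k < n) r ^+ k * u k <= e 0%N - r ^+ n * e n.
Proof.
move=> r0 ue; elim: n => [|n IHn]; first by rewrite big_ord0 expr0 mul1r subrr.
rewrite big_ord_recr/= exprSr.
have := ler_wpM2l (exprn_ge0 n r0) (ue n).
rewrite mulrBr mulrA => uen.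
by rewrite (le_trans (lerD IHn uen))// addrA subrK.
Qed.

Section green_bound.
Context d (T : measurableType d) (R : realType) (P : probability T R).
Variables (B : nat -> {RV P >-> R}) (mu : probability R R) (x : R).
Hypothesis B_iid : iid_with_law B mu.
Variables (rho : probability R R) (w : R -> R) (K : R).
Hypothesis bw : bounded_measurable w.
Hypothesis w_ge0 : forall t, 0 <= w t.
Hypothesis h_ge0 : forall y, 0 <= trig_integral rho w (fun=> 0) y.
Hypothesis resolvent_le : forall r : R, 0 <= r -> r < 1 ->
  \int[rho]_t (w t * (resolvent_den mu r t)^-1) <= K.

Let X := reflected_walk B x.
Let h := trig_integral rho w (fun=> 0).

Let bX (f : R -> R) k : bounded_measurable f ->
  bounded_measurable (fun v => f (X k v)).
Proof.
by move=> bf; apply: bounded_measurable_comp bf _; exact: measurable_reflected_walk.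
Qed.

Let bh : bounded_measurable h.
Proof.
by apply: bounded_measurable_trig_integral => //; exact: bounded_measurable_cst.
Qed.

(** By evenness of f and independence of the next increment, the right-hand side is the expectation
    of g(X_k), and g >= h. *)
Lemma discounted_potential_ge (r : R) k : 0 <= r -> r < 1 ->
  \int[P]_v h (X k v) <=
  \int[P]_v potential rho mu w r (X k v) -
  r * \int[P]_v potential rho mu w r (X k.+1 v).
Proof.
move=> r0 r1; have bpot := bounded_measurable_potential rho mu bw r0 r1.
rewrite (Rintegral_reflected_walkS x B_iid k bpot (potential_normr _ _ _ _)).
have bpot2 : bounded_measurable
    (fun z : R => \int[mu]_y potential rho mu w r (z - y)).
  apply: (bounded_measurable_Rintegral1 mu mu
    (F := fun z : R * R => potential rho mu w r (z.1 - z.2))).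
  apply: bounded_measurable_comp bpot _.
  exact: measurable_funB.
rewrite -RintegralZl//; last exact/bounded_measurable_integrable/(bX k bpot2).
rewrite -RintegralB//; last 2 first.
- exact/bounded_measurable_integrable/(bX k bpot).
- apply: bounded_measurable_integrable; apply: bounded_measurableM.
    exact: bounded_measurable_cst.
  exact: (bX k bpot2).
under [leRHS]eq_Rintegral do rewrite potential_charge//.
apply: bounded_measurable_le_Rintegral; first exact: bX.
  exact/bX/bounded_measurable_charge.
by move=> v; exact: charge_ge.
Qed.

(** Instead of a limit r -> 1, a value of r is chosen for each n with r^k >= 1/2 for all k <= n;
    this is harmless because K does not depend on r. The telescoped discounted sum is at most 2 K,
    and the discount costs another factor 2. *)
Lemma green_bound n : \sum_(k < n) \int[P]_v h (X k v) <= 4 * K.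
Proof.
(* With r = 1 - y, the Bernoulli inequality gives r^k >= 1 - k y >= 1/2 for k <= n; the successor
   keeps the inverse meaningful when n = 0. *)
pose y : R := (2 * n.+1%:R)^-1.
have n0 : 0 < (n.+1%:R : R) by [].
have y0 : 0 < y by rewrite invr_gt0 mulr_gt0.
have ny : n.+1%:R * y = 2^-1.
  by rewrite /y invfM mulrCA mulfV ?mulr1// gt_eqF.
have y1 : y <= 2^-1.
  by rewrite -ny ler_peMl ?(ltW y0)// ler1n.
have y01 : 0 <= y <= 1 by rewrite (ltW y0) (le_trans y1)// invf_le1 ?ler1n.
pose r := 1 - y.
have r0 : 0 <= r by rewrite subr_ge0; case/andP: y01.
have r1 : r < 1 by rewrite ltrBlDr ltrDl.
have rn k : (k <= n)%N -> 2^-1 <= r ^+ k.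
  move=> kn; rewrite (le_trans _ (bernoulli_ineq k y01))//.
  have : k%:R * y <= n.+1%:R * y by rewrite ler_wpM2r ?(ltW y0)// ler_nat leqW.
  by rewrite ny; lra.
pose e k := \int[P]_v potential rho mu w r (X k v).
have eK k : `|e k| <= K.
  apply: bounded_measurable_normr_Rintegral.
    by have [] := bX k (bounded_measurable_potential rho mu bw r0 r1).
  by move=> v; apply: potential_le => //; exact: resolvent_le.
have etel : \sum_(k < n) r ^+ k * \int[P]_v h (X k v) <= e 0%N - r ^+ n * e n.
  apply: (discounted_telescope (u := fun k => \int[P]_v h (X k v))) => // k.
  exact: discounted_potential_ge.
have h2 : 2^-1 * \sum_(k < n) \int[P]_v h (X k v) <= 2 * K.
  apply: (@le_trans _ _ (\sum_(k < n) r ^+ k * \int[P]_v h (X k v))).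
    rewrite mulr_sumr; apply: ler_sum => k _; rewrite ler_wpM2r//.
      by apply: Rintegral_ge0 => v _; exact: h_ge0.
    exact/rn/ltnW.
  rewrite (le_trans etel)// (le_trans (ler_norm _))//.
  rewrite (le_trans (ler_normB _ _))// normrM mulr_natl mulr2n lerD//.
  rewrite (le_trans _ (eK n))// ler_piMl// ger0_norm ?exprn_ge0//.
  by rewrite exprn_ile1// ltW.
have -> : 4 * K = 2 * (2 * K) by rewrite mulrA -natrM.
by rewrite -ler_pdivrMl.
Qed.

(** Since h >= c on [-M, M] and h >= 0 elsewhere, P(|X_k| <= M) is at most E h(X_k) / c. These
    probabilities have sum at most 4 K / c, and Borel-Cantelli applies. *)
Lemma reflected_walk_visits (M c : R) : 0 < c ->
  (forall y, `|y| <= M -> c <= h y) ->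
  P (lim_sup_set (fun k => [set v | `|X k v| <= M])) = 0%E.
Proof.
move=> c0 hc.
pose A k := [set v | `|X k v| <= M].
have mX k : measurable_fun setT (fun v => `|X k v|).
  by apply: measurableT_comp => //; exact: measurable_reflected_walk.
have mA k : measurable (A k).
  rewrite (_ : A k = (fun v => `|X k v|) @^-1` `]-oo, M]); last first.
    by apply/seteqP; split => v /=; rewrite in_itv.
  by rewrite -[_ @^-1` _]setTI; exact: (mX k).
apply: lim_sup_set_cvg0 => //.
have PA k : (P (A k) <= (c^-1 * \int[P]_v h (X k v))%:E)%E.
  rewrite -[leLHS]fineK ?fin_num_measure// lee_fin ler_pdivlMl//.
  have bI : bounded_measurable (\1_(A k) : T -> R).
    split; first exact: measurable_indic.
    by exists 1 => v; rewrite indicE; case: (_ \in _); rewrite ?normr0 ?normr1.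
  have -> : fine (P (A k)) =
      \int[P]_v \1_(A k) v.
    by rewrite /Rintegral integral_indic// setIT.
  rewrite -RintegralZl//; last exact: bounded_measurable_integrable.
  apply: bounded_measurable_le_Rintegral.
  - by apply: bounded_measurableM => //; exact: bounded_measurable_cst.
  - exact: bX.
  move=> v; rewrite indicE; case: (boolP (v \in _)) => [|_].
    by rewrite inE/= mulr1 => /hc.
  by rewrite mulr0 h_ge0.
apply: (@le_lt_trans _ _ (c^-1 * (4 * K))%:E); last exact: ltry.
apply: lime_le; first by apply: is_cvg_nneseries => k _ _; exact: measure_ge0.
apply: nearW => n; rewrite big_mkord.
apply: (@le_trans _ _ (\sum_(k < n) (c^-1 * \int[P]_v h (X k v))%:E)%E).
  by apply: lee_sum => k _; exact: PA.
rewrite sumEFin lee_fin -mulr_sumr.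
by rewrite ler_wpM2l ?invr_ge0 ?(ltW c0)// green_bound.
Qed.

End green_bound.

(** * From finitely many visits to bounded sets to transience *)

Lemma transient_of_null_visits d (T : measurableType d) (R : realType)
    (P : probability T R) (B : nat -> {RV P >-> R}) :
  (forall (x M : R), 0 < M ->
    P (lim_sup_set (fun k => [set v | `|reflected_walk B x k v| <= M])) = 0%E) ->
  transient_reflected_walk B.
Proof.
move=> visits x _.
pose A (M : nat) k := [set v | `|reflected_walk B x k v| <= M.+1%:R].
have mA M k : measurable (A M k).
  have mX : measurable_fun setT (fun v => `|reflected_walk B x k v|).
    by apply: measurableT_comp => //; exact: measurable_reflected_walk.
  rewrite (_ : A M k = (fun v => `|reflected_walk B x k v|) @^-1` `]-oo, M.+1%:R]).
    by rewrite -[_ @^-1` _]setTI; exact: mX.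
  by apply/seteqP; split => v /=; rewrite in_itv.
pose N := \bigcup_M lim_sup_set (A M).
have mL M : measurable (lim_sup_set (A M)).
  by apply: bigcap_measurable => // k _; apply: bigcup_measurable.
have mN : measurable N by exact: bigcup_measurable.
have PN : P N = 0%E.
  apply/negligibleP => //; apply: negligible_bigcup => M.
  by apply/negligibleP => //; exact: visits.
(* Divergence is exactly the complement of [N]: it means that, for each integer M, the walk is
   eventually above M + 1. The shift by x is absorbed by the triangle inequality. *)
rewrite (_ : [set _ | _] = ~` N).
  by rewrite probability_setC// PN sube0.
apply/seteqP; split => v.
  move=> /cvgryPge Xoo [M _ AM].
  have [n _ nX] := Xoo (M.+1%:R + `|x| + 1).
  have [k /= nk] := AM n I; rewrite /A/= => kM.
  have := nX k nk; have := ler_normB (reflected_walk B x k v) x; lra.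
move=> nN; apply/cvgryPge => a.
have [M aM] : exists M : nat, a + `|x| <= M.+1%:R.
  exists (Num.bound `|a + `|x| |); rewrite (le_trans (ler_norm _))// ltW//.
  by rewrite (lt_trans (archi_boundP _))// ltr_nat.
have : ~ lim_sup_set (A M) v by move=> ?; apply: nN; exists M.
rewrite /lim_sup_set /bigcap/= => /existsNP[n /not_implyP[_ nA]].
exists n => // k /= nk.
have kA : ~ A M k v by move=> ?; apply: nA; exists k.
move/negP: kA; rewrite -ltNge => kA.
have := lerB_dist (reflected_walk B x k v) x; lra.
Qed.

(** * The Fejer kernel *)

(** A form with derivatives assumed on the closed interval, endpoints included; continuity of F then
    supplies the one-sided limits. *)
Lemma FTC2_is_derive (R : realType) (f F : R -> R) (a b : R) : a < b ->
  (forall t, a <= t <= b -> is_derive t 1 F (f t)) ->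
  (forall t, a <= t <= b -> {for t, continuous f}) ->
  (\int[lebesgue_measure]_(t in `[a, b]) (f t)%:E = (F b - F a)%:E)%E.
Proof.
move=> ab dF cf; rewrite EFinB.
have cF t : a <= t <= b -> {for t, continuous F}.
  move=> /dF [dFt _].
  by apply/differentiable_continuous/derivable1_diffP.
apply: continuous_FTC2 => //.
- by apply: continuous_in_subspaceT => t; rewrite inE/= in_itv/=; exact: cf.
- split.
  + move=> t; rewrite in_itv/= => /andP[at_ tb].
    by have [] : is_derive t 1 F (f t) by apply: dF; rewrite !ltW.
  + by apply: cvg_at_right_filter; apply: cF; rewrite lexx ltW.
  + by apply: cvg_at_left_filter; apply: cF; rewrite lexx ltW.
- move=> t; rewrite in_itv/= => /andP[at_ tb]; rewrite derive1E.
  by have [] : is_derive t 1 F (f t) by apply: dF; rewrite !ltW.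
Qed.

Section uniform_law.
Context (R : realType).

Definition borel_idfun : measurableTypeR R -> R := idfun.

Lemma measurable_borel_idfun : measurable_fun setT borel_idfun.
Proof. exact: (@measurable_id _ _ setT). Qed.

HB.instance Definition _ :=
  isMeasurableFun.Build _ _ _ _ borel_idfun measurable_borel_idfun.

(* [uniform_prob] lives on [measurableTypeR R], which differs from [R] by its
   display. *)
Definition uniform_law (a b : R) (ab : a < b) : probability R R :=
  distribution (uniform_prob ab) borel_idfun.

End uniform_law.

(** The formula is first obtained for nonnegative integrands; adding the bound M to f and
    subtracting the constant M reduces the general case to that one. *)
Lemma Rintegral_uniform_law (R : realType) (a b : R) (ab : a < b) (f : R -> R) :
  bounded_measurable f ->
  \int[uniform_law ab]_t f t =
  (b - a)^-1 * \int[lebesgue_measure]_(t in `[a, b]) f t.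
Proof.
move=> bf; have [mf [M fM]] := bf.
have bM : bounded_measurable (fun _ : R => M) by exact: bounded_measurable_cst.
have bfM : bounded_measurable (fun t => f t + M) by exact: bounded_measurableD.
have fM0 t : 0 <= f t + M by have /ler_normlP[] := fM t; lra.
have M0 : 0 <= M by exact: le_trans (normr_ge0 (f 0)) (fM 0).
have il (g : R -> R) : bounded_measurable g ->
    (@lebesgue_measure R).-integrable `[a, b] (EFin \o g).
  move=> [mg [N gN]]; apply: measurable_bounded_integrable => //.
  - by rewrite /= lebesgue_measure_itv/=; case: ifP => _; rewrite -?EFinB ltry.
  - exact: measurable_funTS.
  - by exists N; split; [exact: num_real|move=> z Nz y _; exact: le_trans (gN y) (ltW Nz)].
have uge0 (g : R -> R) : bounded_measurable g -> (forall t, 0 <= g t) ->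
    \int[uniform_law ab]_t g t =
    (b - a)^-1 * \int[lebesgue_measure]_(t in `[a, b]) g t.
  move=> bg g0; have mg : measurable_fun setT (EFin \o g).
    by apply/measurable_EFinP; have [] := bg.
  rewrite /Rintegral ge0_integral_distribution// integral_uniform//.
  by rewrite fineM// integrable_fin_num//; exact: il.
have -> : \int[uniform_law ab]_t f t =
    \int[uniform_law ab]_t (f t + M) - \int[uniform_law ab]_t M.
  rewrite -RintegralB//; do ?exact: bounded_measurable_integrable.
  by apply: eq_Rintegral => t _; rewrite addrK.
rewrite !uge0// -mulrBr -RintegralB//; do ?exact: il.
by congr (_ * _); apply: eq_Rintegral => t _; rewrite addrK.
Qed.

Section triangle_weight.
Context (R : realType).
Variables (a : R) (a0 : 0 < a).

(** The cut-off outside [0, a] makes the weight bounded and nonnegative on the whole line. *)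
Definition triangle_weight (t : R) : R := (a - t) * \1_(`[0, a]) t.

Lemma triangle_weight_ge0 t : 0 <= triangle_weight t.
Proof.
rewrite /triangle_weight indicE; case: (boolP (t \in _)) => [|_]; last by rewrite mulr0.
by rewrite inE/= in_itv/= => /andP[_ ta]; rewrite mulr1 subr_ge0.
Qed.

Lemma triangle_weight_le t : triangle_weight t <= a.
Proof.
rewrite /triangle_weight indicE; case: (boolP (t \in _)) => [|_].
  by rewrite inE/= in_itv/= => /andP[t0 _]; rewrite mulr1 gerBl.
by rewrite mulr0 ltW.
Qed.

Lemma bounded_measurable_triangle_weight : bounded_measurable triangle_weight.
Proof.
split; first by apply: measurable_funM; [exact: measurable_funB|exact: measurable_indic].
by exists a => t; rewrite ger0_norm ?triangle_weight_ge0// triangle_weight_le.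
Qed.

Definition fejer (x : R) : R :=
  trig_integral (uniform_law a0) triangle_weight (fun=> 0) x.

Lemma fejerE x :
  fejer x = a^-1 * \int[lebesgue_measure]_(t in `[0, a]) ((a - t) * cos (t * x)).
Proof.
rewrite /fejer /trig_integral Rintegral_uniform_law; last first.
  apply: bounded_measurable_trig_integrand.
    exact: bounded_measurable_triangle_weight.
  exact: bounded_measurable_cst.
rewrite subr0; congr (_ * _); apply: eq_Rintegral => t ta.
by rewrite /triangle_weight indicE ta mulr1 mul0r addr0.
Qed.

Lemma fejer0 : fejer 0 = a / 2.
Proof.
rewrite fejerE; under eq_Rintegral do rewrite mulr0 cos0 mulr1.
pose F t : R := a * t - t ^+ 2 / 2.
have dF t : 0 <= t <= a -> is_derive t 1 F (a - t).
  move=> _; apply: is_derive_eq.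
  by rewrite /GRing.scale/= !mulr0 add0r !mulr1; lra.
have cf t : 0 <= t <= a -> {for t, continuous (fun t => a - t)}.
  by move=> _; apply: continuousB; [exact: cst_continuous|exact: cvg_id].
rewrite /Rintegral (FTC2_is_derive a0 dF cf)/= /F.
by field; rewrite gt_eqF.
Qed.

Lemma fejer_neq0 (x : R) : x != 0 -> fejer x = a^-1 * ((1 - cos (a * x)) / x ^+ 2).
Proof.
move=> x0; rewrite fejerE; congr (_ * _); rewrite /Rintegral.
have dlin (t : R) : is_derive t 1 (fun s : R => s * x) x.
  by apply: is_derive_eq; rewrite /GRing.scale/= mulr0 mulr1 add0r.
(* This primitive comes from integrating (a - t) cos(t x) by parts. *)
pose F t : R := (a - t) * sin (t * x) / x - cos (t * x) / x ^+ 2.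
have dF t : 0 <= t <= a -> is_derive t 1 F ((a - t) * cos (t * x)).
  move=> _.
  have dsin : is_derive t 1 (fun t => sin (t * x)) (x * cos (t * x)).
    by apply: is_derive_eq; rewrite mulrC.
  have dcos : is_derive t 1 (fun t => cos (t * x)) (- (x * sin (t * x))).
    by apply: is_derive_eq; rewrite mulNr mulrC.
  apply: is_derive_eq; rewrite /GRing.scale/=.
  by move: (cos _) (sin _) => u v; field.
have cf t : 0 <= t <= a -> {for t, continuous (fun t => (a - t) * cos (t * x))}.
  move=> _; apply: continuousM.
    by apply: continuousB; [exact: cst_continuous|exact: cvg_id].
  apply: continuous_comp; last exact: continuous_cos.
  exact: mulrr_continuous.
rewrite (FTC2_is_derive a0 dF cf)/= /F.
by rewrite subrr !mul0r cos0 sin0 mulr0 mul0r; field.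
Qed.

Lemma fejer_ge0 x : 0 <= fejer x.
Proof.
have [->|x0] := eqVneq x 0; first by rewrite fejer0 divr_ge0// ltW.
rewrite fejer_neq0// mulr_ge0 ?invr_ge0 ?(ltW a0)//.
by rewrite divr_ge0 ?exprn_even_ge0// subr_ge0 cos_le1.
Qed.

(** The integrand is at least half of its value at x = 0, and [fejer a0 0] equals a / 2. *)
Lemma fejer_ge (x : R) : (forall t : R, 0 <= t <= a -> 2^-1 <= cos (t * x)) ->
  a / 4 <= fejer x.
Proof.
move=> cosx; have -> : a / 4 = 2^-1 * fejer 0 by rewrite fejer0; field.
have bw := bounded_measurable_triangle_weight.
have b0 : bounded_measurable (fun _ : R => 0 : R) by exact: bounded_measurable_cst.
have bi (y : R) := bounded_measurable_trig_integrand bw b0 y.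
rewrite /fejer /trig_integral -RintegralZl//; last exact: bounded_measurable_integrable.
apply: bounded_measurable_le_Rintegral => [|//|t].
  by apply: bounded_measurableM => //; exact: bounded_measurable_cst.
rewrite !mul0r !addr0 mulr0 cos0 mulr1 mulrC.
have [ta|ta] := boolP (t \in `[0, a]).
  by rewrite ler_wpM2l ?triangle_weight_ge0// cosx// -in_itv.
by rewrite /triangle_weight indicE (_ : (_ \in _) = false) ?mulr0 ?mul0r//;
  apply/negbTE; rewrite notin_setE/=; exact/negP.
Qed.

End triangle_weight.

(** * The characteristic function near the origin *)

Section log_integral.
Context (R : realType).
Variables (p : R) (p_gt1 : 1 < p).

Definition log_density (t : R) : R := t `^ (-1) * (- ln t) `^ (- p).

(** A primitive of 1 / (t (log (1/t))^p) on ]0, 1[. It stays nonnegative near 0 because p > 1, so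
    the integral up to t is controlled by its value at t. *)
Definition log_primitive (t : R) : R := (p - 1)^-1 * (- ln t) `^ (1 - p).

Lemma measurable_log_density : measurable_fun setT log_density.
Proof.
apply: measurable_funM; first exact: measurable_powR.
apply: (measurableT_comp (measurable_powR (- p))).
by apply: measurable_funN; exact: measurable_ln.
Qed.

Lemma log_primitive_ge0 (t : R) : 0 <= log_primitive t.
Proof. by rewrite mulr_ge0 ?powR_ge0// invr_ge0 subr_ge0 ltW. Qed.

Let dNln (t : R) : 0 < t -> is_derive t 1 (fun s : R => - ln s) (- t^-1).
Proof. by move=> t0; apply: is_deriveN; exact: is_derive1_ln. Qed.

Let dpow (e t : R) : 0 < t < 1 ->
  is_derive t 1 (fun s => (- ln s) `^ e) (e * (- ln t) `^ (e - 1) * - t^-1).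
Proof.
move=> /andP[t0 t1].
apply: (@is_derive1_comp _ (fun s => s `^ e) (fun s => - ln s)).
  by apply: is_derive1_powR; rewrite oppr_gt0 ln_lt0// t0.
exact: dNln.
Qed.

Lemma is_derive_log_primitive (t : R) : 0 < t < 1 ->
  is_derive t 1 log_primitive (log_density t).
Proof.
move=> t01; have /andP[t0 t1] := t01.
have dp := dpow (1 - p) t01.
apply: (@is_derive_eq _ _ _ log_primitive).
rewrite /GRing.scale/= /log_density powR_inv1 ?(ltW t0)//.
rewrite (_ : 1 - p - 1 = - p); last by ring.
by field; rewrite (gt_eqF t0) subr_eq0 (gt_eqF p_gt1).
Qed.

Lemma continuous_log_density (t : R) : 0 < t < 1 -> {for t, continuous log_density}.
Proof.
move=> t01; have /andP[t0 t1] := t01.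
apply: continuousM; apply/differentiable_continuous/derivable1_diffP.
  by have [] := @is_derive1_powR _ (-1) t t0.
by have [] := dpow (- p) t01.
Qed.

(** The singularity at 0 is cut off at a small z: the crude bound N costs at most N z <= e on
    [0, z], and the primitive handles [z, a]. The conclusion is free of N, which matters because N
    will depend on r while A will not. *)
Lemma integral_le_log_primitive (a N A : R) (G : R -> R) : 0 < a < 1 -> 0 <= A ->
  measurable_fun setT G -> (forall t, 0 <= G t <= N) ->
  (forall t, 0 < t <= a -> G t <= A * log_density t) ->
  \int[lebesgue_measure]_(t in `[0, a]) G t <= A * log_primitive a.
Proof.
move=> /andP[a0 a1] A0 mG GN GA.
have G0 t : 0 <= G t by case/andP: (GN t).
have N0 : 0 <= N by rewrite (le_trans (G0 0))//; case/andP: (GN 0).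
apply/ler_addgt0Pr => e e0.
(* The first term ensures N z <= e, with N + 1 positive even if N = 0; the second ensures z < a. *)
pose z := Num.min (e / (N + 1)) (a / 2).
have N1 : 0 < N + 1 by rewrite ltr_wpDl.
have z0 : 0 < z by rewrite lt_min !divr_gt0.
have za : z < a by rewrite /z gt_min; apply/orP; right; lra.
have zN : N * z <= e.
  have : N * z <= N * (e / (N + 1)) by rewrite ler_wpM2l// ge_min lexx.
  move=> /le_trans; apply; rewrite mulrA ler_pdivrMr//.
  by rewrite mulrDr mulr1 mulrC lerDl ltW.
have mGE (D : set R) : measurable_fun D (EFin \o G).
  by apply: measurable_funTS; exact/measurable_EFinP.
have mLE (D : set R) : measurable_fun D (fun t => (A * log_density t)%:E).
  apply: measurable_funTS; apply/measurable_EFinP.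
  by apply: measurable_funM => //; exact: measurable_log_density.
rewrite -lee_fin /Rintegral.
have I0z : (\int[lebesgue_measure]_(t in `[0%R, z]) (G t)%:E <= (N * z)%:E)%E.
  apply: (@le_trans _ _ (\int[lebesgue_measure]_(t in `[0%R, z]) (cst N%:E t))%E).
    apply: ge0_le_integral => //=.
    - by move=> t _; rewrite lee_fin.
    - exact: mGE.
    - by move=> t _; rewrite lee_fin; case/andP: (GN t).
  by rewrite integral_cst//= lebesgue_measure_itv/= lte_fin z0 oppr0 adde0 EFinM.
have Iza : (\int[lebesgue_measure]_(t in `[z, a]) (G t)%:E <=
    (A * log_primitive a)%:E)%E.
  apply: (@le_trans _ _
    (\int[lebesgue_measure]_(t in `[z, a]) (A * log_density t)%:E)%E).
    apply: ge0_le_integral => //=.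
    - by move=> t _; rewrite lee_fin.
    - exact: mGE.
    - exact: mLE.
    - move=> t; rewrite in_itv/= => /andP[zt ta].
      by rewrite lee_fin GA// ta (lt_le_trans z0).
  have t01 (t : R) : z <= t <= a -> 0 < t < 1.
    by move=> /andP[zt ta]; rewrite (lt_le_trans z0)// (le_lt_trans ta).
  have dF (t : R) : z <= t <= a ->
      is_derive t 1 (fun s => A * log_primitive s) (A * log_density t).
    by move=> /t01 /is_derive_log_primitive dt; exact: is_deriveZ.
  have cf (t : R) : z <= t <= a -> {for t, continuous (fun s => A * log_density s)}.
    move=> /t01 /continuous_log_density ct.
    by apply: continuousM => //; exact: cst_continuous.
  rewrite (FTC2_is_derive za dF cf) lee_fin gerBl mulr_ge0//.
  exact: log_primitive_ge0.
have le0a : (\int[lebesgue_measure]_(t in `[0%R, a]) (G t)%:E <=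
    (A * log_primitive a + e)%:E)%E.
  rewrite (@itv_bndbnd_setU _ _ _ (BRight z)) ?bnd_simp ?(ltW z0) ?(ltW za)//.
  rewrite ge0_integral_setU//.
  - rewrite integral_itv_obnd_cbnd; last exact: mGE.
    by rewrite addrC EFinD leeD// (le_trans I0z)// lee_fin.
  - exact: mGE.
  - by move=> t _; rewrite lee_fin.
  by rewrite disj_set2E; apply/eqP; rewrite -subset0 => t [] /=;
    rewrite !in_itv/= => /andP[_ tz] /andP[zt _]; move: zt; rewrite ltNge tz.
rewrite fineK//; apply/fin_numP; split.
  by rewrite gt_eqF// (lt_le_trans (ltNyr 0))//; apply: integral_ge0 => t _; rewrite lee_fin.
by rewrite lt_eqF// (le_lt_trans le0a)// ltry.
Qed.

End log_integral.

(** * Lower bounds for 1 minus the characteristic function *)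

Section characteristic_bounds.
Context (R : realType).
Variable mu : probability R R.

Lemma mean_cos_geN1 (t : R) : -1 <= mean_cos mu t.
Proof.
suff /ler_normlP[] : `|mean_cos mu t| <= 1 by rewrite lerNl.
apply: bounded_measurable_normr_Rintegral => [|y]; last exact: cos_max.
have [] // := @bounded_measurable_cos _ _ R (fun y : R => t * y).
exact: measurable_funM.
Qed.

(** Uniform in r: for C in [-1, 1] and r in [0, 1[ one has 1 - r C >= (1 - C) / 2 >= 0, and the
    squared imaginary part is dropped. *)
Lemma resolvent_den_ge_mean_cos (r t : R) : 0 <= r -> r < 1 ->
  (1 - mean_cos mu t) ^+ 2 / 4 <= resolvent_den mu r t.
Proof.
move=> r0 r1; have C1 := mean_cos_le1 mu t; have CN1 := mean_cos_geN1 t.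
have -> : (1 - mean_cos mu t) ^+ 2 / 4 = ((1 - mean_cos mu t) / 2) ^+ 2 by field.
rewrite /resolvent_den -[leLHS]addr0 lerD ?sqr_ge0//.
move: (mean_cos mu t) C1 CN1 => C C1 CN1.
have le12 : (1 - C) / 2 <= 1 - r * C by nra.
have C0 : 0 <= (1 - C) / 2 by lra.
by rewrite ler_sqr// nnegrE (le_trans C0).
Qed.

Lemma cos_le0_pihalf_pi (u : R) : pi / 2 <= u <= pi -> cos u <= 0.
Proof.
move=> /andP[u1 u2]; rewrite -[u](subrK (pi / 2)) cosDpihalf oppr_le0.
apply: sin_ge0_pi; rewrite subr_ge0 u1/=.
have := pi_gt0 R; lra.
Qed.

(** For y in [al, 2 al] the angle t y lies in [pi/2, pi], where the cosine is nonpositive; hence 1 -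
    cos(t y) dominates the indicator of that interval. *)
Lemma measure_le_onem_mean_cos (t al : R) : 0 < t -> t * al = pi / 2 ->
  fine (mu `[al, 2 * al]%classic) <= 1 - mean_cos mu t.
Proof.
move=> t0 tal.
have bcos : bounded_measurable (fun y : R => cos (t * y)).
  by apply: bounded_measurable_cos; exact: measurable_funM.
have b1 : bounded_measurable (fun _ : R => 1 : R) by exact: bounded_measurable_cst.
have bI : bounded_measurable (\1_(`[al, 2 * al]) : R -> R).
  split; first exact: measurable_indic.
  by exists 1 => v; rewrite indicE; case: (_ \in _); rewrite ?normr0 ?normr1.
have -> : 1 - mean_cos mu t = \int[mu]_y (1 - cos (t * y)).
  rewrite RintegralB//; do ?exact: bounded_measurable_integrable.
  by rewrite Rintegral_probability_cst.
have -> : fine (mu `[al, 2 * al]%classic) = \int[mu]_y \1_(`[al, 2 * al]) y.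
  by rewrite /Rintegral integral_indic// setIT.
apply: bounded_measurable_le_Rintegral => // [|y].
  exact: bounded_measurableB.
rewrite indicE; case: (boolP (y \in _)) => [|_]; last by rewrite subr_ge0 cos_le1.
rewrite inE/= in_itv/= => /andP[aly yal].
rewrite lerBrDl gerDr; apply: cos_le0_pihalf_pi.
rewrite -tal ler_pM2l// aly/=.
have -> : pi = t * (2 * al) by rewrite mulrCA tal; field.
by rewrite ler_pM2l.
Qed.

End characteristic_bounds.

(** * Effect of the heavy tail on the characteristic function *)

Section heavy_tail.
Context (R : realType).
Variables (mu : probability R R) (phi : R -> R) (b c : R).
Hypothesis phi_density : has_density_on_Rplus mu phi.
Hypotheses (b_gt0 : 0 < b) (c_gt0 : 0 < c).
Hypothesis phi_equiv : phi ~_(+oo_R) (fun x => c * ln x `^ b / x `^ (3 / 2)).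

Lemma density_ge_eventually : exists2 x0, 2 <= x0 &
  forall y, x0 <= y -> c / 2 * ln y `^ b / y `^ (3 / 2) <= phi y.
Proof.
have half_gt0 : 0 < 2^-1 :> R by rewrite invr_gt0.
have /eqaddoP /(_ 2^-1 half_gt0) [x1 [_ near_phi]] := phi_equiv.
(* The neighbourhood of infinity consists of y > x1 with a strict inequality, whence x1 + 1; the
   bound 2 keeps logarithms positive. *)
exists (Num.max 2 (x1 + 1)); first by rewrite le_max lexx.
move=> y; rewrite ge_max => /andP[y2 y1].
have := near_phi y ltac:(by rewrite (lt_le_trans _ y1)// ltrDl).
have g0 : 0 <= c * ln y `^ b / y `^ (3 / 2).
  by rewrite !mulr_ge0 ?invr_ge0 ?powR_ge0// ltW.
rewrite (ger0_norm g0) => /ler_normlP[+ _].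
set g := c * _ / _.
have -> : c / 2 * ln y `^ b / y `^ (3 / 2) = g / 2 by rewrite /g; ring.
change (- (phi y - g) <= 2^-1 * g -> g / 2 <= phi y).
by move: g (phi y) => u v; lra.
Qed.

(** On an interval of length al, the density is bounded below by taking the logarithm at the left
    end and the power in the denominator at the right end. *)
Lemma measure_dyadic_ge : exists2 x0, 2 <= x0 & forall al, x0 <= al ->
  al * (c / 2 * ln al `^ b / (2 * al) `^ (3 / 2)) <= fine (mu `[al, 2 * al]%classic).
Proof.
have [x0 x02 phi_ge] := density_ge_eventually.
exists x0 => // al x0al; have [mphi phi0 muE] := phi_density.
have al0 : 0 < al by rewrite (lt_le_trans _ x0al)// (lt_le_trans _ x02).
set k := c / 2 * _ / _.
have k0 : 0 <= k by rewrite !mulr_ge0 ?invr_ge0 ?powR_ge0// ltW.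
have sub : `[al, 2 * al]%classic `<=` `[0, +oo[%classic.
  by move=> y /=; rewrite !in_itv/= andbT => /andP[+ _]; apply: le_trans; exact: ltW.
rewrite -lee_fin fineK ?fin_num_measure// muE// setIidl//.
apply: (@le_trans _ _ (\int[lebesgue_measure]_(y in `[al, (2 * al)%R]) (cst k%:E y))%E).
  rewrite integral_cst//= lebesgue_measure_itv/= lte_fin.
  by rewrite ltr_pMl// ltr1n -EFinB -EFinM lee_fin mulrC mulr_natl mulr2n addrK.
apply: ge0_le_integral => //.
- by apply/measurable_EFinP; apply: measurable_funS mphi.
move=> y /=; rewrite in_itv/= => /andP[aly yal]; rewrite lee_fin.
have y0 : 0 < y by rewrite (lt_le_trans al0).
rewrite (le_trans _ (phi_ge y (le_trans x0al aly)))//.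
rewrite /k ler_pM ?invr_ge0 ?powR_ge0//.
- by rewrite mulr_ge0 ?powR_ge0// divr_ge0// ltW.
- rewrite ler_wpM2l ?divr_ge0 ?(ltW c_gt0)//.
  have al1 : 1 <= al by rewrite (le_trans _ x0al)// (le_trans _ x02)// ler1n.
  rewrite ge0_ler_powR ?(ltW b_gt0)// ?nnegrE ?ln_ge0// ?(le_trans al1)//.
  by rewrite ler_ln ?posrE.
- rewrite lef_pV2 ?posrE ?powR_gt0// ?mulr_gt0//.
  by rewrite ge0_ler_powR ?nnegrE ?(ltW y0) ?mulr_ge0 ?(ltW al0)// divr_ge0.
Qed.

(** With al = pi / (2 t), the mass of [al, 2 al] is at least of order (ln al)^b / al^(1/2). Its
    square is of order t (ln al)^(2 b), and ln al >= - ln t because pi / 2 >= 1. *)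
Lemma onem_mean_cos_ge : exists2 a1, 0 < a1 < 1 & forall t, 0 < t <= a1 ->
  c ^+ 2 / (16 * pi) * (t * (- ln t) `^ (2 * b)) <= (1 - mean_cos mu t) ^+ 2.
Proof.
have [x0 x02 mu_ge] := measure_dyadic_ge.
have x00 : 0 < x0 by rewrite (lt_le_trans _ x02).
(* For t <= 1 / x0 one gets al >= 1 / t >= x0, the range where the mass estimate holds. *)
exists x0^-1.
  by rewrite invr_gt0 x00 invf_lt1// (lt_le_trans _ x02)// ltr1n.
move=> t /andP[t0 tx0].
have pi0 : 0 < pi :> R by exact: pi_gt0.
have [al alE] : exists al, al = pi / (2 * t) by exists (pi / (2 * t)).
have tal : t * al = pi / 2 by rewrite alE; field; rewrite gt_eqF.
have tVal : t^-1 <= al.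
  have -> : al = (pi / 2) * t^-1 by rewrite alE; field; rewrite gt_eqF.
  by rewrite ler_peMl ?invr_ge0 ?(ltW t0)// pihalf_ge1.
have x0al : x0 <= al.
  by rewrite (le_trans _ tVal)// -[x0]invrK lef_pV2 ?posrE ?invr_gt0.
have al0 : 0 < al by rewrite (lt_le_trans x00).
have lnal : - ln t <= ln al.
  by rewrite -lnV ?posrE// ler_ln ?posrE ?invr_gt0.
have lnt : 0 <= - ln t.
  by rewrite oppr_ge0 ln_le0// (le_trans tx0)// invf_le1// (le_trans _ x02)// ler1n.
have le_mu := le_trans (mu_ge al x0al) (measure_le_onem_mean_cos mu t0 tal).
have k0 : 0 <= al * (c / 2 * ln al `^ b / (2 * al) `^ (3 / 2)).
  by rewrite !mulr_ge0 ?invr_ge0 ?powR_ge0 ?(ltW al0) ?(ltW c_gt0).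
apply: (@le_trans _ _ ((al * (c / 2 * ln al `^ b / (2 * al) `^ (3 / 2))) ^+ 2)); last first.
  by rewrite ler_sqr// nnegrE (le_trans k0).
have pow3 : ((2 * al) `^ (3 / 2)) ^+ 2 = (2 * al) ^+ 3.
  by rewrite -powR_mulrn ?powR_ge0// -powRrM divfK// powR_mulrn// mulr_ge0// ltW//.
have powb : (ln al `^ b) ^+ 2 = ln al `^ (2 * b).
  by rewrite -powR_mulrn ?powR_ge0// -powRrM mulrC.
(* The square is al^2 (c^2 / 4) (ln al)^(2 b) / (8 al^3), and 1 / al = 2 t / pi gives the constant
   c^2 / (16 pi). *)
have -> : (al * (c / 2 * ln al `^ b / (2 * al) `^ (3 / 2))) ^+ 2 =
    c ^+ 2 / (16 * pi) * (t * ln al `^ (2 * b)).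
  rewrite !exprMn !exprVn pow3 powb alE.
  by move: (@pi R) (gt_eqF pi0) => q q0; field; rewrite (gt_eqF t0) q0.
rewrite ler_wpM2l ?divr_ge0 ?sqr_ge0 ?mulr_ge0 ?(ltW pi0)// ler_wpM2l ?(ltW t0)//.
by rewrite ge0_ler_powR ?nnegrE ?mulr_ge0 ?(ltW b_gt0)// (le_trans lnt).
Qed.

End heavy_tail.

(** * Choice of the kernel and conclusion *)

Lemma cos_ge_half_near0 (R : realType) :
  exists2 e : R, 0 < e & forall y : R, `|y| <= e -> 2^-1 <= cos y.
Proof.
have : \forall y \near (0 : R), 2^-1 < cos y.
  have half_gt0 : 0 < 2^-1 :> R by rewrite invr_gt0.
  have /cvgrPdist_lt /(_ 2^-1 half_gt0) := @continuous_cos R 0.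
  rewrite cos0.
  apply: filterS => y /=; have := ler_norm (1 - cos y); lra.
move=> [e /= e0 He]; exists (e / 2); first by rewrite divr_gt0.
move=> y ye; apply/ltW/He; rewrite /= sub0r normrN.
by rewrite (le_lt_trans ye)//; lra.
Qed.

Theorem proposition5p12 (R : realType) (mu0 : probability R R) (phi0 : R -> R)
    (b c : R)
    (mu0_Rplus : mu0 `[0, +oo[%classic = 1%E)
    (phi0_density : has_density_on_Rplus mu0 phi0)
    (phi0_decreasing : {in `]0, +oo[ &, nonincreasing_fun phi0})
    (b_gt : 2^-1 < b) (c_gt0 : 0 < c)
    (phi0_equiv : phi0 ~_(+oo_R) (fun x => c * ln x `^ b / x `^ (3 / 2)))
    (d : measure_display) (T : measurableType d) (P : probability T R)
    (B : nat -> {RV P >-> R})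
    (B_iid : iid_with_law B mu0) :
  transient_reflected_walk B.
Proof.
have b_gt0 : 0 < b by rewrite (lt_trans _ b_gt)// invr_gt0.
have [a1 /andP[a10 a11] C_ge] :=
  onem_mean_cos_ge phi0_density b_gt0 c_gt0 phi0_equiv.
have [e e0 cos_ge] := cos_ge_half_near0 R.
apply: transient_of_null_visits => x M M0.
(* The kernel depends on M: a <= a1 keeps the support of the weight where the characteristic
   function is controlled, and a M <= e gives cos(t y) >= 1/2 for 0 <= t <= a and |y| <= M. *)
pose a := Num.min a1 (e / M).
have a0 : 0 < a by rewrite lt_min a10 divr_gt0.
have aa1 : a <= a1 by rewrite ge_min lexx.
have aM : a * M <= e by rewrite -ler_pdivlMr// ge_min lexx orbT.
have a01 : 0 < a < 1 by rewrite a0 (le_lt_trans aa1).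
(* This is where b > 1/2 enters: it makes 1 / (t (log (1/t))^(2 b)) integrable at 0. *)
have p_gt1 : 1 < 2 * b by rewrite -ltr_pdivrMl// mulr1.
have pi0 : 0 < pi :> R by exact: pi_gt0.
set k := c ^+ 2 / (16 * pi) in C_ge.
have k0 : 0 < k by rewrite divr_gt0 ?exprn_gt0// mulr_gt0.
clearbody k.
(* The factor a bounds the weight; 4 / k comes from inverting the lower bound k t (- ln t)^(2 b) / 4
   on the denominator. *)
pose A := a * (4 / k).
have A0 : 0 <= A by rewrite mulr_ge0 ?(ltW a0)// divr_ge0// ltW.
have bw := bounded_measurable_triangle_weight a0.
have resolvent_le (r : R) : 0 <= r -> r < 1 ->
    \int[uniform_law a0]_t (triangle_weight a t * (resolvent_den mu0 r t)^-1) <=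
    a^-1 * (A * log_primitive (2 * b) a).
  move=> r0 r1.
  have bi := bounded_measurable_inv_resolvent_den mu0 r0 r1.
  (* The bound N obtained here depends on r but does not enter the final estimate. *)
  have bG := bounded_measurableM bw bi; have [mG [N GN]] := bG.
  have G0 t : 0 <= triangle_weight a t * (resolvent_den mu0 r t)^-1.
    by rewrite mulr_ge0 ?triangle_weight_ge0// invr_ge0 ltW// resolvent_den_gt0.
  rewrite Rintegral_uniform_law// subr0 ler_wpM2l ?invr_ge0 ?(ltW a0)//.
  apply: (@integral_le_log_primitive _ _ p_gt1 _ N) => // t.
    by rewrite G0 (le_trans (ler_norm _)).
  move=> /andP[t0 ta].
  have lnt : 0 < - ln t.
    by rewrite oppr_gt0 ln_lt0// t0 (le_lt_trans ta)//; case/andP: a01.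
  have q0 : 0 < t * (- ln t) `^ (2 * b) by rewrite mulr_gt0// powR_gt0.
  have den_ge : k * (t * (- ln t) `^ (2 * b)) / 4 <= resolvent_den mu0 r t.
    rewrite (le_trans _ (resolvent_den_ge_mean_cos mu0 t r0 r1))// ler_pM2r//.
    by apply: C_ge; rewrite t0 (le_trans ta).
  rewrite /A -[leRHS]mulrA ler_pM ?triangle_weight_ge0 ?triangle_weight_le//.
    by rewrite invr_ge0 ltW// resolvent_den_gt0.
  have -> : 4 / k * log_density (2 * b) t = (k * (t * (- ln t) `^ (2 * b)) / 4)^-1.
    by rewrite /log_density powR_inv1 ?(ltW t0)// powRN !invfM invrK; ring.
  by rewrite lef_pV2 ?posrE ?resolvent_den_gt0// divr_gt0// mulr_gt0.
apply: (reflected_walk_visits x B_iid bw (@triangle_weight_ge0 _ a)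
  (fejer_ge0 a0) resolvent_le (c := a / 4)); first by rewrite divr_gt0.
move=> y yM; apply: fejer_ge => t /andP[t0 ta]; apply: cos_ge.
by rewrite normrM ger0_norm// (le_trans _ aM)// ler_pM.
Qed.
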